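(* There are no $(3,3;+1)$-digraphs, no $(3,15;+1)$-digraphs and no $(3,63;+1)$-digraphs.
   Context: Digraphs are finite and without multiple arcs. A digraph $G$ is $k$-geodetic if for any (not necessarily distinct) vertices $u,v$ there is at most one directed walk from $u$ to $v$ of length at most $k$ (walks of length $0$ count, so there are no directed cycles of length at most $k$). A $(d,k;+1)$-digraph is a $k$-geodetic digraph with minimum out-degree $d$ and order $M(d,k)+1$, where $M(d,k)=1+d+d^2+\dots+d^k$. It is known that every $(d,k;+1)$-digraph with $d,k\ge 2$ is diregular (all in-degrees and out-degrees equal $d$). *)

(* Defs.v *)
From mathcomp Require Import all_boot.

Set Implicit Arguments.
Unset Strict Implicit.
Unset Printing Implicit Defensive.

(* A finite digraph without multiple arcs is a relation [e] on a finite type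
   [V]; [e x y] means that there is an arc from x to y.  Loops are not excluded
   a priori, but [k_geodetic] forbids them as soon as 0 < k. *)

(* [p] lists the vertices visited after [u], so [size p] is the number of arcs;
   the walk of length 0 is [::]. *)
Definition walk (V : finType) (e : rel V) (u v : V) (p : seq V) : bool :=
  path e u p && (last u p == v).

Definition k_geodetic (k : nat) (V : finType) (e : rel V) : Prop :=
  forall (u v : V) (p q : seq V),
    walk e u v p -> walk e u v q -> size p <= k -> size q <= k -> p = q.

Definition outdeg (V : finType) (e : rel V) (u : V) : nat :=
  #|[set v : V | e u v]|.

Definition min_outdeg_is (V : finType) (e : rel V) (d : nat) : Prop :=
  (exists u : V, outdeg e u = d) /\ (forall u : V, d <= outdeg e u).

Definition moore_bound (d k : nat) : nat := \sum_(i < k.+1) d ^ i.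

(* The (d,k;+1)-digraphs. *)
Definition excess_one_digraph (d k : nat) (V : finType) (e : rel V) : Prop :=
  [/\ k_geodetic k e, min_outdeg_is e d & #|V| = (moore_bound d k).+1].

(* Main.v *)
From Stdlib Require Import BinNums BinPos BinNat Pnat Nnat.
Require Import Defs.
From mathcomp Require Import all_boot all_order all_algebra all_fingroup all_solvable
  all_field.
(* [order] is the length of an orbit, not the order of a group element. *)
Import fingraph.

(**
Let M(d,k) = 1 + d + ... + d^k and let G be a (3,k;+1)-digraph with adjacency
matrix A and order N = M(3,k) + 1.  Every vertex u reaches all vertices but one,
its outlier o u, by a unique walk of length at most k; so
I + A + ... + A^k = J - P with P the matrix of o.

If G were not in-regular, all the vertices o u would have the same
out-neighbours, and A^(2k+1) would be A^k plus an explicit matrix of rank one;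
as 2k+1 is prime (7, 31, 127), comparing tr A^(2k+1) with tr A modulo 2k+1
excludes this.  Hence o is an automorphism.

The digraph induced by the fixed points of a power o^j is again of this kind,
and regular of some degree 0, 1, 2 or 3, so o^j has 0, 2, k+2, 2^(k+1) or N
fixed points.  On the fixed points of o^2 a trace argument over the rationals
leaves only the sizes 0 and 2; when there are k+2 fixed points they form a
single cycle of o.

As N is odd, some odd power of o has k+2 or N fixed points.
- If o has odd order, consider its smallest period l.  If o^l = 1, then l = N
  because N is prime, and G is a circulant digraph, which is not 2-geodetic.
  If o^l has k+2 fixed points, it exchanges the two out-neighbours of a fixed
  point that it does not fix, which contradicts the odd order.
- If o has a cycle C of length k+2, the same exchange shows that o^(2(k+2)) has
  more than k+2 fixed points, hence 2^(k+1) or N.  Both are 1 modulo a prime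
  q = 5 or 17 dividing k+2, so o^(2(k+2)/q), which moves C, has 2^(k+1) fixed
  points.  The same descent with the prime 13 for k = 63 leads to o^2, which has
  at most 2 fixed points.
*)

Set Implicit Arguments.
Unset Strict Implicit.
Unset Printing Implicit Defensive.

(** * Sums of natural numbers that exceed one *)

Lemma sum_nat_gt1 (I : finType) (P : pred I) (F : I -> nat) :
  1 < \sum_(i | P i) F i ->
  (exists2 i, P i & 1 < F i) \/
  (exists i j, [/\ P i, P j, i != j, 0 < F i & 0 < F j]).
Proof.
move=> gt1.
have [i /andP[Pi Fi] | all0] := pickP (fun i => P i && (0 < F i)); last first.
  suff s0 : \sum_(i | P i) F i = 0 by rewrite s0 in gt1.
  apply: big1 => i Pi; move/negbT: (all0 i); rewrite Pi /= lt0n negbK.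
  by move/eqP.
have [Fi1 | Fi1] := ltnP 1 (F i); first by left; exists i.
right; exists i; move: gt1; rewrite (bigD1 i) //= => gt1.
have: 0 < \sum_(j | P j && (j != i)) F j.
  by rewrite -(ltn_add2l (F i)) addn0; apply: leq_ltn_trans gt1.
rewrite lt0n sum_nat_eq0 => /forallPn[j].
rewrite negb_imply -lt0n => /andP[/andP[Pj ji] Fj].
by exists j; rewrite eq_sym ji.
Qed.

Lemma leq_sum_gt0 (I : finType) (P : pred I) (F : I -> nat) (i j : I) :
  P i -> P j -> i != j -> 0 < F i -> 0 < F j -> 1 < \sum_(x | P x) F x.
Proof.
move=> Pi Pj ij Fi Fj; rewrite (bigD1 i) //= (bigD1 j) /=; last first.
  by rewrite Pj eq_sym.
by rewrite addnA; apply: leq_trans (leq_addr _ _); apply: (@leq_add 1 1).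
Qed.

(** * Counting walks of bounded length *)

Section Walks.
Variables (V : finType) (e : rel V).

Fixpoint nwalks (n : nat) (u v : V) : nat :=
  if n is m.+1 then \sum_(w | e u w) nwalks m w v else u == v.

Definition reach (k : nat) (u v : V) : nat := \sum_(i < k.+1) nwalks i u v.

Definition indeg (v : V) : nat := #|[set u | e u v]|.

Lemma nwalks_gt0 n u v : 0 < nwalks n u v ->
  exists2 p, walk e u v p & size p = n.
Proof.
elim: n u => [|n IHn] u /=.
  by rewrite lt0b => /eqP->; exists [::]; rewrite // /walk /= eqxx.
rewrite lt0n sum_nat_eq0 => /forallPn[w].
rewrite negb_imply -lt0n => /andP[euw /IHn[p wp <-]].
by exists (w :: p) => //; move: wp; rewrite /walk /= euw.
Qed.

Lemma nwalks_gt1 n u v : 1 < nwalks n u v ->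
  exists p q, [/\ walk e u v p, walk e u v q, size p = n, size q = n & p != q].
Proof.
elim: n u => [|n IHn] u /=; first by case: (u == v).
case/sum_nat_gt1 => [[w euw /IHn[p [q [wp wq sp sq pq]]]] | [w [w' [ew ew' ww']]]].
  exists (w :: p), (w :: q); move: wp wq; rewrite /walk /= euw sp sq.
  by rewrite eqseq_cons eqxx /= pq.
move=> /nwalks_gt0[p wp <-] /nwalks_gt0[q wq sq].
exists (w :: p), (w' :: q); move: wp wq; rewrite /walk /= ew ew' sq.
by rewrite eqseq_cons (negbTE ww').
Qed.

Lemma geodetic_reach_le1 k u v : k_geodetic k e -> reach k u v <= 1.
Proof.
move=> geo; rewrite leqNgt; apply/negP.
case/sum_nat_gt1 => [[i _ /nwalks_gt1[p [q [wp wq sp sq]]]] | [i [j [_ _ ij]]]].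
  by rewrite (geo _ _ _ _ wp wq) ?eqxx ?sp ?sq // -ltnS.
move=> /nwalks_gt0[p wp sp] /nwalks_gt0[q wq sq].
move: ij; rewrite -(inj_eq val_inj) /= -sp -sq.
by rewrite (geo _ _ _ _ wp wq) ?eqxx ?sp ?sq // -ltnS.
Qed.

Lemma nwalks1 u v : nwalks 1 u v = e u v.
Proof.
rewrite /= big_mkcond (bigD1 v) //= eqxx big1 ?addn0 => [|i /negbTE ->].
  by case: (e u v).
by case: (e u i).
Qed.

Lemma nwalksSr n u v : nwalks n.+1 u v = \sum_(w | e w v) nwalks n u w.
Proof.
elim: n u => [|n IHn] u.
  rewrite nwalks1 /= big_mkcond (bigD1 u) //= eqxx big1 ?addn0 => [|w].
    by case: (e u v).
  by rewrite eq_sym => /negbTE ->; case: (e w v).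
rewrite [LHS]/= (eq_bigr _ (fun w _ => IHn w)) exchange_big /=.
by apply: eq_bigr.
Qed.

(* The entries of [A (I + A + ... + A^k)] and of [(I + A + ... + A^k) A]. *)
Lemma reach_comm k u v :
  \sum_(w | e u w) reach k w v = \sum_(w | e w v) reach k u w.
Proof.
rewrite /reach exchange_big [RHS]exchange_big /=.
by apply: eq_bigr => i _; rewrite -nwalksSr.
Qed.

Lemma nwalks_le_reach k n u v : n <= k -> nwalks n u v <= reach k u v.
Proof.
by rewrite -ltnS => nk; rewrite /reach (bigD1 (Ordinal nk)) //= leq_addr.
Qed.

Lemma nwalksD_le_reach k m n u v : m < n -> n <= k ->
  nwalks m u v + nwalks n u v <= reach k u v.
Proof.
rewrite -[n <= k]ltnS => mn nk; have mk := ltn_trans mn nk.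
rewrite /reach (bigD1 (Ordinal mk)) //= (bigD1 (Ordinal nk)) /=.
  by rewrite addnA leq_addr.
by rewrite -(inj_eq val_inj) /= neq_ltn mn orbT.
Qed.

Definition nwalks_from n u := \sum_v nwalks n u v.

Lemma nwalks_from0 u : nwalks_from 0 u = 1.
Proof.
rewrite /nwalks_from (bigD1 u) //= eqxx big1 // => v /negbTE.
by rewrite eq_sym => ->.
Qed.

Lemma nwalks_fromS n u : nwalks_from n.+1 u = \sum_(w | e u w) nwalks_from n w.
Proof. by rewrite /nwalks_from /= exchange_big. Qed.

Lemma sum_reach k u : \sum_v reach k u v = \sum_(i < k.+1) nwalks_from i u.
Proof. exact: exchange_big. Qed.

Lemma nwalks_from_ge d n u : (forall w, d <= outdeg e w) -> d ^ n <= nwalks_from n u.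
Proof.
move=> ge_d; elim: n u => [|n IHn] u; first by rewrite nwalks_from0.
rewrite nwalks_fromS expnS; apply: leq_trans (_ : outdeg e u * d ^ n <= _).
  by rewrite leq_mul2r ge_d orbT.
rewrite -sum_nat_const; rewrite (eq_bigl (e u)) => [|w]; last by rewrite inE.
by apply: leq_sum => w _.
Qed.

Lemma nwalks_from_reg d n u : (forall w, outdeg e w = d) -> nwalks_from n u = d ^ n.
Proof.
move=> reg; elim: n u => [|n IHn] u; first by rewrite nwalks_from0.
rewrite nwalks_fromS expnS (eq_bigr _ (fun w _ => IHn w)) -(reg u) -sum_nat_const.
by apply: eq_bigl => w; rewrite inE.
Qed.

End Walks.

(** * Out-regularity and the outlier function *)

Section ExcessOne.
Variables (d k : nat) (V : finType) (e : rel V).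
Hypotheses (d_gt0 : 0 < d) (k_gt1 : 1 < k) (exc : excess_one_digraph d k e).

(** A vertex of larger out-degree would reach at least 1 + (d + 1)(1 + d + ... + d^(k-1)) vertices,
    which exceeds M(d,k) + 1 because [k] is at least 2. *)
Lemma excess_outdeg u : outdeg e u = d.
Proof.
have [geo [_ ge_d] cardV] := exc.
apply/eqP; rewrite eqn_leq ge_d andbT leqNgt; apply/negP => lt_d.
have: \sum_v reach e k u v <= #|V|.
  by rewrite -sum1_card; apply: leq_sum => v _; apply: geodetic_reach_le1.
rewrite sum_reach cardV /moore_bound !big_ord_recl nwalks_from0 expn0.
rewrite -addnS leq_add2l; apply/negP; rewrite -ltnNge.
apply: (@leq_trans (\sum_(i < k) (d ^ i + d ^ i.+1))).
  rewrite big_split /= -addn2 addnC leq_add2r.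
  case: k k_gt1 => [|[|m]] // _; rewrite !big_ord_recl /= addnA.
  by apply: leq_trans (leq_addr _ _); rewrite expn0 add1n ltnS expn_gt0 d_gt0.
apply: leq_sum => i _; rewrite nwalks_fromS expnS -mulSn.
apply: (@leq_trans (outdeg e u * d ^ i)); first by rewrite leq_mul2r lt_d orbT.
rewrite -sum_nat_const (eq_bigl (e u)) => [|w]; last by rewrite inE.
by apply: leq_sum => w _; apply: nwalks_from_ge.
Qed.

End ExcessOne.

(** The entrywise form of I + A + ... + A^k = J - P. It expresses at once the uniqueness of short
    walks and the single vertex that they miss. *)
Definition is_outlier (k : nat) (V : finType) (e : rel V) (o : V -> V) : Prop :=
  forall u v, reach e k u v = (v != o u).

(** For fixed [u] the numbers [reach e k u v] are at most 1 and add up to M(d,k), one less than the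
    order, so exactly one of them vanishes. *)
Lemma excess_outlier d k (V : finType) (e : rel V) :
  0 < d -> 1 < k -> excess_one_digraph d k e -> exists o, is_outlier k e o.
Proof.
move=> d_gt0 k_gt1 exc; have [geo _ cardV] := exc.
have unique_outlier u : exists o, [set v | reach e k u v == 0] == [set o].
  suff /cards1P[o ->]: #|[set v | reach e k u v == 0]| == 1 by exists o.
  rewrite -(eqn_add2l (moore_bound d k)) addn1 -cardV; apply/eqP.
  rewrite -cardsT -(cardsID [set v | reach e k u v == 0] setT) setTI addnC;
    congr (_ + _).
  transitivity (\sum_v reach e k u v).
    rewrite sum_reach; apply: eq_bigr => i _; apply/esym/nwalks_from_reg.
    exact: excess_outdeg exc.
  rewrite -sum1_card [RHS]big_mkcond /=; apply: eq_bigr => v _; rewrite !inE andbT.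
  by have := geodetic_reach_le1 u v geo; case: (reach _ _ _ _) => [|[]].
exists (fun u => xchoose (unique_outlier u)) => u v.
have /eqP/setP/(_ v) := xchooseP (unique_outlier u); rewrite !inE => <-.
by have := geodetic_reach_le1 u v geo; case: (reach _ _ _ _) => [|[]].
Qed.

Section Outlier.
Variables (k : nat) (V : finType) (e : rel V) (o : V -> V).
Hypothesis oP : is_outlier k e o.

Lemma reach_le1 u v : reach e k u v <= 1.
Proof. by rewrite oP; case: (_ != _). Qed.

Lemma outlier_neq u : o u != u.
Proof.
have: 0 < reach e k u u.
  by apply: leq_trans (nwalks_le_reach e u u (leq0n k)); rewrite /= eqxx.
by rewrite oP eq_sym; case: (_ != _).
Qed.

Lemma no_transitive_triangle u w v : 1 < k -> e u w -> e w v -> ~~ e u v.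
Proof.
move=> k_gt1 uw wv; have := nwalksD_le_reach e u v (ltnSn 1) k_gt1.
move/leq_trans/(_ (reach_le1 u v)); rewrite nwalks1.
suff: 0 < nwalks e 2 u v by case: (nwalks _ _ _ _); case: (e u v).
by rewrite nwalksSr (bigD1 w) //= -/(nwalks e 1 u w) nwalks1 uw.
Qed.

Lemma two_walk_unique u w w' v : 1 < k ->
  e u w -> e w v -> e u w' -> e w' v -> w = w'.
Proof.
move=> k_gt1 uw wv uw' w'v; apply/eqP/negPn/negP => neq.
have := leq_trans (nwalks_le_reach e u v k_gt1) (reach_le1 u v).
rewrite nwalksSr leqNgt => /negP[].
by apply: (leq_sum_gt0 wv w'v neq); rewrite nwalks1 ?uw ?uw'.
Qed.

(** This is one entry of A(J - P) = (J - P)A, with the negative terms moved across. *)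
Lemma outlier_degrees u v :
  outdeg e u + e (o u) v = indeg e v + #|[set w | e u w & o w == v]|.
Proof.
have out_split : outdeg e u =
    \sum_(w | e u w) reach e k w v + #|[set w | e u w & o w == v]|.
  rewrite /outdeg -!sum1_card (eq_bigr _ (fun w _ => oP w v)).
  rewrite [in RHS]big_mkcond [X in _ + X]big_mkcond [LHS]big_mkcond -big_split /=.
  apply: eq_bigr => w _; rewrite !inE [v == _]eq_sym.
  by case: (e u w); case: (_ == _).
have in_split : indeg e v = \sum_(w | e w v) reach e k u w + e (o u) v.
  rewrite /indeg -!sum1_card (eq_bigr _ (fun w _ => oP u w)).
  transitivity (\sum_(w | e w v) (w != o u) + \sum_(w | w == o u) e w v).
    rewrite [in RHS]big_mkcond [X in _ + X]big_mkcond [LHS]big_mkcond -big_split /=.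
    by apply: eq_bigr => w _; rewrite !inE; case: (e w v); case: (_ == _).
  by rewrite big_pred1_eq.
by rewrite out_split in_split reach_comm addnAC.
Qed.

Hypotheses (o_inj : injective o) (o_hom : forall u v, e (o u) (o v) = e u v).

(** For an automorphism [o] the two correction terms of [outlier_degrees] cancel. As [u] and [v] are
    independent, all degrees coincide. *)
Lemma outdeg_indeg u v : outdeg e u = indeg e v.
Proof.
have := outlier_degrees u v; suff ->: #|[set w | e u w & o w == v]| = e (o u) v.
  exact: addIn.
have [g og go] := injF_bij o_inj.
have ->: e (o u) v = e u (g v) by rewrite -{1}(go v) o_hom.
case: (boolP (e u (g v))) => ev.
  rewrite -[RHS](cards1 (g v)); apply/eq_card => w; rewrite !inE.
  apply/andP/eqP => [[_ /eqP<-]|->]; last by rewrite go.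
  by rewrite og.
rewrite -[RHS](cards0 V); apply/eq_card => w; rewrite !inE; apply/negP.
by case/andP=> ew /eqP ov; rewrite -ov og ew in ev.
Qed.

Lemma outlier_card d : (forall u, outdeg e u = d) -> 0 < #|V| ->
  #|V| = (moore_bound d k).+1.
Proof.
move=> reg /card_gt0P[u _].
have: \sum_v reach e k u v = moore_bound d k.
  by rewrite sum_reach; apply: eq_bigr => i _; apply: nwalks_from_reg.
move<-; rewrite (eq_bigr _ (fun v _ => oP u v)) (bigD1 (o u)) //= eqxx add0n.
rewrite (cardD1 (o u)) inE add1n; congr _.+1; rewrite -sum1_card.
by rewrite big_mkcond [RHS]big_mkcond; apply: eq_bigr => v _; rewrite !inE andbT;
  case: (_ != _).
Qed.

End Outlier.

(** * Traces modulo a prime and traces of idempotents *)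

Section TraceLemmas.
Import GRing.Theory.
Local Open Scope ring_scope.

Lemma det_exp (R : comNzRingType) n (M : 'M[R]_n) m : \det (M ^+ m) = (\det M) ^+ m.
Proof.
by elim: m => [|m IHm]; rewrite ?expr0 ?det1 // !exprS det_mulmx IHm.
Qed.

Lemma Fp_poly_exp p (f : {poly 'F_p}) : prime p -> f ^+ p = f \Po 'X^p.
Proof.
move=> p_pr; have pF : p \in [pchar {poly 'F_p}] by rewrite pchar_poly pchar_Fp.
elim/poly_ind: f => [|f c IHf]; first by rewrite comp_poly0 expr0n; case: p p_pr {pF}.
rewrite -(pFrobenius_autE pF) pFrobenius_autD_comm; last exact: mulrC.
rewrite !pFrobenius_autE exprMn IHf comp_polyD comp_polyM comp_polyX comp_polyC.
congr (_ + _); rewrite -rmorphXn /=; congr _%:P.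
by have := expf_card c; rewrite card_Fp.
Qed.

(* Over a field with p elements, [char_poly M ^+ p] is both
   [char_poly (M ^+ p) \Po 'X^p] and [char_poly M \Po 'X^p]. *)
Lemma mxtrace_exp_Fp p n (M : 'M['F_p]_n) : prime p -> \tr (M ^+ p) = \tr M.
Proof.
move=> p_pr; case: n M => [|n] M; first by rewrite /mxtrace !big_ord0.
have p_gt0 := prime_gt0 p_pr.
have pM : p \in [pchar 'M[{poly 'F_p}]_n.+1].
  apply: (rmorph_pchar (@scalar_mx {poly 'F_p} n.+1)).
  by rewrite pchar_poly pchar_Fp.
have charE : char_poly (M ^+ p) \Po 'X^p = char_poly M \Po 'X^p.
  rewrite -(Fp_poly_exp (char_poly M)) // /char_poly -det_exp.
  rewrite -(pFrobenius_autE pM) pFrobenius_autB_comm; last exact: comm_scalar_mx.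
  rewrite !pFrobenius_autE -!rmorphXn /=. 
  rewrite -[LHS](det_map_mx (comp_poly 'X^p)) map_mxB map_scalar_mx /= comp_polyX.
  congr (\det (_ - _)).
  by apply/matrixP => i j; rewrite !mxE comp_polyC.
(* For a matrix of size [n.+1], minus the trace is the coefficient of degree [n], which the
   substitution of ['X^p] moves to degree [p * n]. *)
have coefE (A : 'M['F_p]_n.+1) : (char_poly A \Po 'X^p)`_(p * n) = - \tr A.
  rewrite (coef_comp_poly_Xn _ _ p_gt0) (dvdn_mulr n (dvdnn p)) (mulKn n p_gt0).
  exact: (char_poly_trace A (ltn0Sn n)).
have := coefE (M ^+ p); rewrite charE coefE => eq_tr.
by move/oppr_inj: eq_tr => ->.
Qed.

(** A full-rank factorisation M = C B of an idempotent satisfies B C = 1, so the trace is the rank,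
    and in characteristic 0 it vanishes only if the rank does. *)
Lemma idempotent_trace0 (F : fieldType) n (M : 'M[F]_n) :
  [pchar F] =i pred0 -> M *m M = M -> \tr M = 0 -> M = 0.
Proof.
move=> F0 MM trM; set C := col_base M; set B := row_base M.
have CB : C *m B = M by apply: mulmx_base.
have BC : B *m C = 1%:M.
  apply: (row_full_inj (col_base_full M)); apply: (row_free_inj (row_base_free M)).
  by rewrite -/C -/B mulmxA mulmx1 CB -mulmxA CB MM.
have trCB : \tr (C *m B) = 0 by rewrite CB.
apply/eqP; rewrite -mxrank_eq0.
by rewrite mxtrace_mulC BC mxtrace1 in trCB; rewrite -(proj1 (pcharf0P F) F0) trCB.
Qed.

End TraceLemmas.

(** * The adjacency matrix and the outlier matrix *)

Section AdjacencyMatrix.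
Import GRing.Theory.
Local Open Scope ring_scope.

Definition relmx (R : pzRingType) (V : finType) (e : rel V) : 'M[R]_#|V| :=
  \matrix_(i, j) (e (enum_val i) (enum_val j))%:R.

Variables (k : nat) (V : finType) (e : rel V) (o : V -> V).
Hypothesis oP : is_outlier k e o.
Variable R : pzRingType.
Let A := relmx R e.
Let P := relmx R (fun u v => v == o u).

Lemma sum_enum_val (F : V -> R) : \sum_(i < #|V|) F (enum_val i) = \sum_v F v.
Proof. by rewrite [RHS]big_enum_val. Qed.

Lemma adjmx_exp n i j : (A ^+ n) i j = (nwalks e n (enum_val i) (enum_val j))%:R.
Proof.
elim: n i => [|n IHn] i.
  by rewrite expr0 !mxE /= (inj_eq enum_val_inj); case: (i == j).
rewrite exprS !mxE /=.
rewrite (eq_bigr (fun l => (e (enum_val i) (enum_val l))%:R *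
                            (nwalks e n (enum_val l) (enum_val j))%:R)); last first.
  by move=> l _; rewrite mxE IHn.
rewrite (sum_enum_val (fun w => (e (enum_val i) w)%:R * (nwalks e n w (enum_val
  j))%:R)).
rewrite natr_sum [RHS]big_mkcond; apply: eq_bigr => w _.
by case: (e _ w); rewrite ?mul1r ?mul0r.
Qed.

Lemma sum_adjmx_exp : \sum_(i < k.+1) A ^+ i = const_mx 1 - P.
Proof.
apply/matrixP => i j; rewrite summxE !mxE.
rewrite (eq_bigr _ (fun (l : 'I_k.+1) _ => adjmx_exp l i j)) -natr_sum.
rewrite -/(reach e k (enum_val i) (enum_val j)) oP.
by case: (_ == _); rewrite /= ?subrr ?subr0.
Qed.

(** A closed walk of such a length would compete with the empty walk. *)
Lemma mxtrace_adjX n : (0 < n <= k)%N -> \tr (A ^+ n) = 0.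
Proof.
case/andP=> n_gt0 n_le; rewrite /mxtrace big1 // => i _; rewrite adjmx_exp.
have := nwalksD_le_reach e (enum_val i) (enum_val i) n_gt0 n_le.
move/leq_trans/(_ (reach_le1 oP _ _)); rewrite /= eqxx.
by case: (nwalks _ _ _ _).
Qed.

Lemma mul_outlier_mx n (M : 'M[R]_(#|V|, n)) i j :
  (P *m M) i j = M (enum_rank (o (enum_val i))) j.
Proof.
rewrite !mxE (bigD1 (enum_rank (o (enum_val i)))) //= !mxE enum_rankK eqxx mul1r.
rewrite big1 ?addr0 // => l l_o; rewrite !mxE; case: eqP => [lo|];
  last by rewrite mul0r.
by rewrite -lo enum_valK eqxx in l_o.
Qed.

End AdjacencyMatrix.

(** * In-regularity *)

Section InDegrees.
Variables (d k : nat) (V : finType) (e : rel V) (o : V -> V).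
Hypotheses (oP : is_outlier k e o) (k_gt1 : 1 < k).
Hypothesis out_reg : forall u, outdeg e u = d.

Lemma outdeg_sum u : outdeg e u = \sum_v e u v.
Proof.
rewrite /outdeg -sum1_card big_mkcond.
by apply: eq_bigr => v _; rewrite inE; case: (e u v).
Qed.

Lemma indeg_sum v : indeg e v = \sum_u e u v.
Proof.
rewrite /indeg -sum1_card big_mkcond.
by apply: eq_bigr => u _; rewrite inE; case: (e u v).
Qed.

Lemma sum_indeg : \sum_v indeg e v = d * #|V|.
Proof.
rewrite (eq_bigr _ (fun v _ => indeg_sum v)) exchange_big /= mulnC -sum_nat_const.
by apply: eq_bigr => u _; rewrite -outdeg_sum.
Qed.

(** The in-degrees have mean [d], so if they vary, one of them exceeds [d]. The vertices of
    in-degree above [d] are then exactly the out-neighbours of each [o u]. *)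
Lemma outlier_out_const v : indeg e v != d ->
  forall u u' w, e (o u) w = e (o u') w.
Proof.
move=> irr; have [v0 v0_gt] : exists v0, d < indeg e v0.
  have [v0 v0_gt|no_gt] := pickP (fun v0 => d < indeg e v0); first by exists v0.
  have le_d w : indeg e w <= d by rewrite leqNgt no_gt.
  have : \sum_w indeg e w < \sum_(w : V) d.
    rewrite (bigD1 v) //= [X in _ < X](bigD1 v) //= -addSn leq_add //.
      by rewrite ltn_neqAle irr le_d.
    by apply: leq_sum => w _.
  by rewrite sum_indeg sum_nat_const mulnC ltnn.
have heavy w : d < indeg e w -> forall u, e (o u) w.
  move=> w_gt u; have := outlier_degrees oP u w; rewrite out_reg.
  case: (e (o u) w) => //; rewrite addn0 => /esym dE; move: w_gt.
  by rewrite -dE ltnNge leq_addr.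
(* If [w] were [o x] for an out-neighbour [x] of [u], then [o u], [w] and [v0] would form a
   transitive triangle. *)
have arc_heavy u w : e (o u) w -> d < indeg e w.
  move=> ew; have := outlier_degrees oP u w; rewrite out_reg ew addn1.
  rewrite (_ : [set _ | _] = set0) ?cards0 ?addn0 => [->//|].
  apply/setP => x; rewrite !inE; apply/negP => /andP[_ /eqP xw].
  have := no_transitive_triangle oP k_gt1 ew.
  by rewrite -xw => /(_ v0 (heavy _ v0_gt x)); rewrite heavy.
by move=> u u' w; apply/idP/idP => /arc_heavy/heavy.
Qed.

End InDegrees.

Section InRegular.
Import GRing.Theory.
Local Open Scope ring_scope.
Variables (d k : nat) (V : finType) (e : rel V) (o : V -> V).
Hypotheses (oP : is_outlier k e o) (k_gt1 : (1 < k)%N).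
Hypothesis out_reg : forall u, outdeg e u = d.
Hypothesis cardV : #|V| = (moore_bound d k).+1.
Hypothesis p_prime : prime k.*2.+1.
Hypothesis d_ndvd : d%:R ^+ k * (d%:R ^+ k.+1 - 1) != 0 :> 'F_(k.*2.+1).

(* If some in-degree differs from d, all the vertices [o u] have the same
   out-neighbours, so that (I + A + ... + A^k) A has equal rows; then
   A^(2k+1) = A^k + (d-1) d^(k-1) (I + A + ... + A^k) A and the traces are
   compared modulo the prime 2k+1. *)
Lemma excess_indeg v : indeg e v = d.
Proof.
apply/eqP; apply: contraNT d_ndvd => irr; apply/eqP.
pose A := relmx 'F_(k.*2.+1) e.
pose z w : 'F_(k.*2.+1) := (indeg e w)%:R - (e (o v) w)%:R.
pose Z : 'M['F_(k.*2.+1)]_#|V| := \matrix_(i, j) z (enum_val j).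
have SA : (\sum_(i < k.+1) A ^+ i) * A = Z.
  rewrite (sum_adjmx_exp oP) mulrBl; apply/matrixP => i j.
  rewrite [LHS]mxE [X in _ + X]mxE -[_ * A]/(_ *m A) mul_outlier_mx !mxE enum_rankK.
  rewrite (outlier_out_const oP k_gt1 out_reg irr _ v); congr (_ - _).
  rewrite (eq_bigr (fun l => (e (enum_val l) (enum_val j))%:R)); last first.
    by move=> l _; rewrite !mxE mul1r.
  by rewrite (sum_enum_val (fun w => (e w (enum_val j))%:R)) -natr_sum -indeg_sum.
have AZ : A * Z = d%:R *: Z.
  apply/matrixP => i j; rewrite !mxE.
  rewrite (eq_bigr (fun l => (e (enum_val i) (enum_val l))%:R * z (enum_val j))).
    rewrite -mulr_suml (sum_enum_val (fun w => (e (enum_val i) w)%:R)) -natr_sum.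
    by rewrite -outdeg_sum out_reg.
  by move=> l _; rewrite !mxE.
have AnZ n : A ^+ n * Z = d%:R ^+ n *: Z.
  elim: n => [|n IHn]; first by rewrite !expr0 mul1r scale1r.
  by rewrite !exprSr -mulrA AZ -[LHS]scalemxAr [_ *m Z]IHn scalerA mulrC.
have Ak2 : A ^+ k.+2 = A + (d%:R - 1) *: Z.
  apply/eqP; rewrite addrC -subr_eq; apply/eqP.
  transitivity ((A ^+ k.+1 - 1) * A); first by rewrite mulrBl mul1r -exprSr.
  rewrite subrX1 -mulrA SA mulrBl AZ mul1r.
  by rewrite scalerBl scale1r.
have Ap : A ^+ k.*2.+1 = A ^+ k + (d%:R - 1) *: (d%:R ^+ k.-1 *: Z).
  have pE : k.*2.+1 = (k.-1 + k.+2)%N.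
    by rewrite -addnn !addnS -[in RHS]addSn (prednK (ltnW k_gt1)).
  rewrite [X in A ^+ X]pE exprD Ak2 mulrDr -exprSr (prednK (ltnW k_gt1)) -AnZ.
  by congr (_ + _); apply/esym/scalemxAr.
(* The in-degrees add up to [d * #|V|], from which the out-degree [d] of [o v] is subtracted. *)
have trZ : \tr Z = d%:R * (moore_bound d k)%:R.
  rewrite /mxtrace (eq_bigr (fun i => z (enum_val i))); last by move=> i _; rewrite mxE.
  rewrite sum_enum_val sumrB -!natr_sum (sum_indeg out_reg) cardV mulnS natrD.
  by rewrite -outdeg_sum out_reg addrC addKr natrM.
have k_rng : (0 < k <= k)%N by rewrite leqnn (ltnW k_gt1).
have := mxtrace_exp_Fp A p_prime.
rewrite Ap mxtraceD !mxtraceZ (mxtrace_adjX oP _ k_rng).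
have -> : \tr A = 0.
  by rewrite -[A]expr1 (mxtrace_adjX oP) // (ltnW k_gt1).
rewrite add0r trZ subrX1 /moore_bound natr_sum.
rewrite (eq_bigr (fun i : 'I_k.+1 => d%:R ^+ i)); last by move=> i _; rewrite natrX.
move=> eq0; rewrite -[RHS]eq0 mulrCA; congr (_ * _).
by rewrite mulrA -exprSr (prednK (ltnW k_gt1)).
Qed.

End InRegular.

(** * Outlier functions that are involutions *)

Section Involution.
Import GRing.Theory.
Local Open Scope ring_scope.
Variables (k : nat) (V : finType) (e : rel V) (o : V -> V).
Hypotheses (oP : is_outlier k e o) (k_gt1 : (1 < k)%N).
Hypothesis o_hom : forall u v, e (o u) (o v) = e u v.
Hypothesis oo : involutive o.

(* Over the rationals A^(k+1) (I - P) = A (I - P), so that A^k (I - P) / 2 is an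
   idempotent; its trace counts walks that do not exist, hence A (I - P) = 0. *)
Lemma outlier_involution_arcs u v : e u v = e u (o v).
Proof.
pose A := relmx rat e; pose P := relmx rat (fun u v => v == o u).
pose Q := 1 - P.
have k_gt0 := ltnW k_gt1.
have PE (M : 'M_#|V|) i j : (P * M) i j = M (enum_rank (o (enum_val i))) j.
  exact: mul_outlier_mx.
have ME (M : 'M_#|V|) i j : (M * P) i j = M i (enum_rank (o (enum_val j))).
  rewrite [LHS]mxE (bigD1 (enum_rank (o (enum_val j)))) //= !mxE enum_rankK oo eqxx
    mulr1.
  rewrite big1 ?addr0 // => l l_o; rewrite !mxE; case: eqP => [jl|];
    last by rewrite mulr0.
  by rewrite jl oo enum_valK eqxx in l_o.
have AP : A * P = P * A.
  apply/matrixP => i j; rewrite PE ME !mxE !enum_rankK.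
  by rewrite -[in RHS]o_hom oo.
have PP : P * P = 1.
  apply/matrixP => i j; rewrite PE !mxE enum_rankK oo (inj_eq enum_val_inj).
  by rewrite eq_sym; case: (_ == _).
have JP : const_mx 1 * P = const_mx 1 by apply/matrixP => i j; rewrite ME !mxE.
have PQ : P * Q = - Q by rewrite mulrBr mulr1 PP opprB.
have QQ : Q * Q = Q *+ 2 by rewrite {1}/Q mulrBl mul1r PQ opprK mulr2n.
have AQ n : Q * A ^+ n = A ^+ n * Q.
  by apply: commrX; rewrite /GRing.comm mulrBl mulrBr mul1r mulr1 AP.
have SQ : (\sum_(i < k.+1) A ^+ i) * Q = Q.
  by rewrite (sum_adjmx_exp oP) mulrBl PQ opprK mulrBr mulr1 JP subrr add0r.
have Ak1 : A ^+ k.+1 * Q = A * Q.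
  have := congr1 (fun M => M * Q + Q) (subrX1 A k.+1).
  by rewrite -mulrA SQ !mulrBl mul1r !subrK.
have Akn n : A ^+ (k + n.+1) * Q = A ^+ n.+1 * Q.
  by rewrite addnS -addSn addnC exprD -mulrA Ak1 mulrA -exprSr.
pose Y := A ^+ k * Q.
have YY : Y * Y = Y *+ 2.
  rewrite /Y -mulrA [Q * _]mulrA AQ -mulrA QQ mulrA -exprD mulrnAr.
  by rewrite -{2}(prednK k_gt0) Akn prednK.
(* Neither closed walks of length [k] nor walks of length [k] from a vertex to its outlier exist. *)
have trY : \tr Y = 0.
  have k_rng : (0 < k <= k)%N by rewrite leqnn k_gt0.
  rewrite /Y mulrBr mulr1 raddfB /= (mxtrace_adjX oP _ k_rng) sub0r.
  rewrite /mxtrace big1 ?oppr0 // => i _; rewrite ME adjmx_exp enum_rankK.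
  have := nwalks_le_reach e (enum_val i) (o (enum_val i)) (leqnn k).
  by rewrite oP eqxx leqn0 => /eqP->.
have Y0 : Y = 0.
  have: 2^-1 *: Y = 0.
    apply: idempotent_trace0; first exact: Num.Theory.pchar_num.
      rewrite -scalemxAl -scalemxAr -/(Y * Y) YY -scaler_nat !scalerA.
      by congr (_ *: _).
    by rewrite mxtraceZ trY mulr0.
  by move/eqP; rewrite scaler_eq0 => /orP[|/eqP].
have : A * Q = 0 by rewrite -Ak1 exprS -mulrA -/Y Y0 mulr0.
rewrite mulrBr mulr1 => /matrixP/(_ (enum_rank u) (enum_rank v)) /eqP.
rewrite mxE [X in _ + X]mxE ME !mxE !enum_rankK subr_eq0.
by case: (e u v); case: (e u (o v)).
Qed.

(** Along arcs from [u0] to [v] and from [v] to [x], both [v] and [o v] would be midpoints of walks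
    of length 2 from [u0] to [x]. *)
Lemma outlier_not_involution (u0 : V) : (forall u, 0 < outdeg e u)%N -> False.
Proof.
move=> out_gt0.
have /card_gt0P[v] := out_gt0 u0; rewrite inE => uv.
have /card_gt0P[x] := out_gt0 v; rewrite inE => vx.
have uov : e u0 (o v) by rewrite -outlier_involution_arcs.
have ovx : e (o v) x by rewrite -(oo x) o_hom -outlier_involution_arcs.
have := outlier_neq oP v.
by rewrite (two_walk_unique oP k_gt1 uov ovx uv vx) eqxx.
Qed.

End Involution.

(** * Fixed points of iterates, counted modulo a prime *)

Lemma card_fixed_mod (V : finType) (f : V -> V) q : prime q -> (forall x, iter q f x =
  x) ->
  #|V| = #|[set x | f x == x]| %[mod q].
Proof.
move=> q_pr fq.
have f_inj : injective f.
  move=> x y fxy; rewrite -(fq x) -(fq y) -(prednK (prime_gt0 q_pr)) !iterSr.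
  by rewrite fxy.
pose s := perm f_inj.
have sq : (s ^+ q = 1)%g by apply/permP => x; rewrite permX perm1 -[RHS]fq;
  apply: eq_iter => y; rewrite permE.
have qG : (q.-group <[s]>)%g.
  by apply: (pnat_dvd _ (pnat_id q_pr)); rewrite order_dvdn sq.
have acts_s : ([acts <[s]>, on [set: V] | 'P])%g.
  by apply/actsP => a _ x; rewrite !inE.
have := pgroup_fix_mod qG acts_s; rewrite cardsT => ->; congr (_ %% _).
by apply: eq_card => x; rewrite setTI afix_cycle // !inE sub1set inE /= apermE permE.
Qed.

Section FixedPoints.
Variables (V : finType) (f : V -> V).
Hypothesis f_inj : injective f.

Lemma iter_eq_order j x : (iter j f x == x) = (order f x %| j).
Proof.
have iterM m : iter (m * order f x) f x = x.
  by elim: m => [|m IHm] //; rewrite mulSn iterD IHm iter_order.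
rewrite {1}(divn_eq j (order f x)) addnC iterD iterM /dvdn.
apply/eqP/eqP => [it|->] //.
have := findex_iter (ltn_pmod j (order_gt0 f x)).
by rewrite it findex0.
Qed.

(** Divisibility by the orbit length replaces the equation [iter j f x = x], so that inclusions
    between these sets become facts about divisors. *)
Definition fixpts (j : nat) : {set V} := [set x | order f x %| j].

Lemma in_fixpts j x : (x \in fixpts j) = (iter j f x == x).
Proof. by rewrite inE iter_eq_order. Qed.

Lemma fixpts_f j x : x \in fixpts j -> f x \in fixpts j.
Proof. by rewrite !in_fixpts -iterSr iterS => /eqP->. Qed.

Lemma fixpts_mod j q : prime q -> #|fixpts (j * q)| = #|fixpts j| %[mod q].
Proof.
move=> q_pr; pose S := fixpts (j * q).
(* The extension by the identity outside [S] makes [g] a map on all of [V]; the complement of [S]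
   cancels from both counts at the end. *)
pose g x := if x \in S then iter j f x else x.
have iterS m x : x \in S -> iter m f x \in S.
  by move=> xS; elim: m => //= m; apply: fixpts_f.
have giter m x : x \in S -> iter m g x = iter (j * m) f x.
  move=> xS; elim: m => [|m IHm]; first by rewrite muln0.
  by rewrite [LHS]/= IHm {1}/g iterS // -iterD mulnS.
have gq x : iter q g x = x.
  have [xS | xS] := boolP (x \in S).
    by rewrite giter //; apply/eqP; rewrite -in_fixpts.
  by apply: iter_fix; rewrite /g (negbTE xS).
have := card_fixed_mod q_pr gq.
rewrite (_ : [set x | g x == x] = fixpts j :|: ~: S); last first.
  apply/setP => x; rewrite in_setU in_setC in_fixpts inE /g.
  have [xS|xS] := boolP (x \in S); first by rewrite orbF.
  by rewrite eqxx orbT.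
have dis : fixpts j :&: ~: S = set0.
  apply/setP => x; rewrite !inE; apply/negP => /andP[xj /negP[]].
  exact: dvdn_mulr.
rewrite cardsU dis cards0 subn0 -(cardsC S) => /eqP.
by rewrite eqn_modDr => /eqP.
Qed.

End FixedPoints.

Lemma iter_inj (V : finType) (f : V -> V) (f_inj : injective f) j :
  injective (iter j f).
Proof. by elim: j => //= j IHj x y /f_inj/IHj. Qed.

(** * Out-degree one *)

Section OutdegreeOne.
Variables (k : nat) (V : finType) (e : rel V) (o : V -> V).
Hypotheses (oP : is_outlier k e o) (k_gt0 : 0 < k) (o_inj : injective o).
Hypothesis o_hom : forall u v, e (o u) (o v) = e u v.
Hypothesis outdeg1 : forall u, outdeg e u = 1.

(** The arcs are the graph of a permutation [s]. The only vertex that [s] does not reach from [x]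
    within [k] steps is both its image under [k.+1] steps and its preimage, so [o] inverts [s] and
    all cycles have length [k.+2]. *)
Lemma outlier_order1 u : order o u = k.+2.
Proof.
have succP x : {y | forall z, e x z = (z == y)}.
  have [y xy] : {y | e x y}.
    by apply/sigW; have /card_gt0P[y] : 0 < outdeg e x; [rewrite outdeg1 | rewrite inE;
      exists y].
  exists y => z; apply/idP/eqP => [xz|->//].
  have /card_le1_eqP out1 : #|[set z | e x z]| <= 1 by rewrite -/(outdeg e x) outdeg1.
  by apply: out1; rewrite inE.
pose s x := sval (succP x).
have sP x z : e x z = (z == s x) by rewrite /s; case: (succP x).
have s_inj : injective s.
  move=> x y sxy; have /card_le1_eqP in1 : #|[set z | e z (s x)]| <= 1.
    by rewrite -/(indeg e (s x)) -(outdeg_indeg oP o_inj o_hom x) outdeg1.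
  by apply: in1; rewrite inE sP ?sxy.
have nwalksE n x y : nwalks e n x y = (y == iter n s x).
  elim: n x => [|n IHn] x; first by rewrite /= eq_sym.
  rewrite [LHS]/= (eq_bigl (pred1 (s x))) => [|w]; last by rewrite sP.
  by rewrite big_pred1_eq IHn iterSr.
have not_out n x : n <= k -> iter n s x != o x.
  move=> nk; have := nwalks_le_reach e x (iter n s x) nk.
  by rewrite nwalksE eqxx oP; case: (_ != _).
have reached x y : y != o x -> exists2 n, n <= k & y = iter n s x.
  move=> yo; have : reach e k x y != 0 by rewrite oP yo.
  rewrite /reach sum_nat_eq0 => /forallPn[n]; rewrite nwalksE eqb0 negbK => /eqP ->.
  by exists n; rewrite // -ltnS.
have no_return n x : 0 < n <= k -> iter n s x != x.
  case/andP=> n_gt0 nk; have := nwalksD_le_reach e x x n_gt0 nk.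
  move/leq_trans/(_ (reach_le1 oP x x)); rewrite !nwalksE eqxx [_ == iter n s x]eq_sym.
  by case: (_ == _).
have s_neq x : s x != x by apply: (no_return 1).
have so x : s (o x) = x.
  have [n n_le] := reached x _ (s_neq (o x)) : exists2 n, _ & _.
  case: n n_le => [|n] n_le; first by [].
  move=> it; have ox : o x = iter n s x by apply: s_inj it.
  by have := not_out n x (ltnW n_le); rewrite -ox eqxx.
have sk x : iter k.+1 s x = o x.
  apply: contraTeq isT => neq; have [n n_le it] := reached x _ neq.
  case: n n_le it => [|n] n_le it.
    have ox : o x = iter k s x by apply: s_inj; rewrite so -[LHS]it.
    by have := not_out k x (leqnn k); rewrite ox eqxx.
  have: iter (k - n) s x = x.
    apply: (@iter_inj V s s_inj n); rewrite -iterD subnKC ?(ltnW n_le) //.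
    exact: s_inj.
  by move/eqP; rewrite (negbTE (no_return _ _ _)) // subn_gt0 n_le leq_subr.
have orderE n : (order o u %| n) = (order s u %| n).
  have it : iter n s (iter n o u) = u.
    by elim: n => // n IHn; rewrite iterSr iterS so.
  rewrite -!iter_eq_order // -(inj_eq (@iter_inj V s s_inj n)) it eq_sym.
  by [].
have -> : order o u = order s u.
  by apply/eqP; rewrite eqn_dvd orderE dvdnn -orderE dvdnn.
apply/eqP; rewrite eqn_leq; apply/andP; split.
  by apply: dvdn_leq => //; rewrite -iter_eq_order // iterS sk so.
rewrite ltnNge; apply/negP => le_k1.
have := iter_order s_inj u; move/eqP.
have [le_k|gt_k] := leqP (order s u) k.
  by rewrite (negbTE (no_return _ _ _)) // order_gt0.
have -> : order s u = k.+1 by apply/eqP; rewrite eqn_leq le_k1.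
by rewrite sk (negbTE (outlier_neq oP u)).
Qed.

End OutdegreeOne.

(** * The subdigraph induced by the fixed points of a power of [o] *)

Section Automorphism.
Variables (k : nat) (V : finType) (e : rel V) (o : V -> V).
Hypotheses (oP : is_outlier k e o) (o_inj : injective o).
Hypothesis o_hom : forall u v, e (o u) (o v) = e u v.

Lemma iter_hom j u v : e (iter j o u) (iter j o v) = e u v.
Proof. by elim: j => //= j IHj; rewrite o_hom. Qed.

Lemma nwalks_iter j n u v : nwalks e n (iter j o u) (iter j o v) = nwalks e n u v.
Proof.
elim: n u => [|n IHn] u /=; first by rewrite (inj_eq (@iter_inj V o o_inj j)).
rewrite (reindex_inj (@iter_inj V o o_inj j)) /=.
by apply: eq_big => [w|w _]; rewrite ?iter_hom ?IHn.
Qed.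

Variable j : nat.
Let F := fixpts o j.

Let T := {x | x \in F}.
Let eT : rel T := relpre val e.
Let oT (x : T) : T := insubd x (o (val x)).

Let val_oT x : val (oT x) = o (val x).
Proof. by rewrite val_insubd (fixpts_f o_inj (valP x)). Qed.

Let oT_inj : injective oT.
Proof. by move=> x y /(congr1 val); rewrite !val_oT => /o_inj/val_inj. Qed.

Let oT_hom x y : eT (oT x) (oT y) = eT x y.
Proof. by rewrite /eT /= !val_oT o_hom. Qed.

Let val_iter_oT n x : val (iter n oT x) = iter n o (val x).
Proof. by elim: n => //= n <-; rewrite val_oT. Qed.

Let order_oT x : order oT x = order o (val x).
Proof.
have dvd n : (order oT x %| n) = (order o (val x) %| n).
  by rewrite -!iter_eq_order // -(inj_eq val_inj) val_iter_oT.
by apply/eqP; rewrite eqn_dvd dvd dvdnn -dvd dvdnn.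
Qed.

Let sum_sub (P : pred V) (G : V -> nat) :
  (forall w, P w -> w \notin F -> G w = 0) ->
  \sum_(w | P w) G w = \sum_(x : T | P (val x)) G (val x).
Proof.
move=> G0; rewrite (bigID (mem F)) /= addnC big1 => [|w /andP[Pw wF]]; last exact: G0.
rewrite add0n.
rewrite (reindex_omap (val : T -> V) insub) /=; last first.
  by move=> w /andP[_ wF]; rewrite insubT.
by apply: eq_bigl => x; rewrite valK eqxx andbT (valP x) andbT.
Qed.

(** A short walk between fixed points stays inside [F]: if it left [F] at [w], its image under
    [iter j o] would be a second walk with the same ends and length. *)
Let nwalks_sub n x y : n <= k -> nwalks eT n x y = nwalks e n (val x) (val y).
Proof.
elim: n x => [|n IHn] x n_le /=; first by rewrite (inj_eq val_inj).
rewrite [RHS]sum_sub => [|w xw wF]; first by apply: eq_bigr => z _; apply/IHn/ltnW.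
have fixed (z : T) : iter j o (val z) = val z.
  by apply/eqP; rewrite -in_fixpts // (valP z).
apply/eqP; rewrite -leqn0 leqNgt; apply/negP => w_gt0.
have: reach e k (val x) (val y) <= 1 by rewrite oP; case: (_ != _).
rewrite leqNgt => /negP[].
apply: leq_trans (nwalks_le_reach e _ _ n_le).
apply: (@leq_sum_gt0 _ _ _ w (iter j o w)) => //.
- by rewrite -(fixed x) iter_hom.
- by rewrite eq_sym -in_fixpts.
- by rewrite -[X in _ < X]/(nwalks e n _ _) -(fixed y) nwalks_iter.
Qed.

Let oT_outlier : is_outlier k eT oT.
Proof.
move=> x y; rewrite -(inj_eq val_inj) val_oT -oP.
by apply: eq_bigr => i _; rewrite nwalks_sub // -ltnS.
Qed.

Let outdegT x : outdeg eT x = #|[set v in F | e (val x) v]|.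
Proof.
rewrite /outdeg -(card_imset _ val_inj); apply: eq_card => v.
apply/imsetP/setIdP => [[y]|[vF xv]].
  by rewrite inE => xy ->; split; [apply: valP | apply: xy].
by exists (Sub v vF : T) => //; rewrite inE.
Qed.

(* The subdigraph induced by the fixed points of an automorphism inherits the
   outlier function, hence is diregular of some smaller degree. *)
Lemma fixpts_regular : F != set0 ->
  exists2 d, #|F| = (moore_bound d k).+1 &
    forall u, u \in F -> #|[set v in F | e u v]| = d.
Proof.
case/set0Pn=> u uF; pose x : T := Sub u uF.
have reg y : outdeg eT y = outdeg eT x.
  rewrite (outdeg_indeg oT_outlier oT_inj oT_hom y x).
  by rewrite -(outdeg_indeg oT_outlier oT_inj oT_hom x x).
exists (outdeg eT x).
  rewrite -(outlier_card oT_outlier reg); first by rewrite card_sig;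
    apply: eq_card => v; rewrite !inE.
  by apply/card_gt0P; exists x.
by move=> v vF; rewrite -(reg (Sub v vF)) outdegT.
Qed.

Lemma fixpts_order1 : 0 < k ->
  (forall u, u \in F -> #|[set v in F | e u v]| = 1) ->
  forall u, u \in F -> order o u = k.+2.
Proof.
move=> k_gt0 reg u uF; rewrite -(order_oT (Sub u uF)).
apply: (outlier_order1 oT_outlier) => // x.
by rewrite outdegT; apply: (reg _ (valP x)).
Qed.

(** On the fixed points of [iter 2 o] the outlier function is an involution, which excludes positive
    degree; in degree 0 the size is M(0,k) + 1 = 2. *)
Lemma fixpts_involution : 1 < k -> j = 2 -> F != set0 -> #|F| = 2.
Proof.
move=> k_gt1 j2 F0; have [d -> reg] := fixpts_regular F0.
case: d reg => [|d] reg.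
  by rewrite /moore_bound big_ord_recl big1 // => i _; rewrite exp0n.
have /set0Pn[u uF] := F0; exfalso.
apply: (outlier_not_involution oT_outlier k_gt1 oT_hom _ (Sub u uF)) => [x|x].
  by apply: val_inj; rewrite !val_oT; apply/eqP; have := valP x;
    rewrite in_fixpts // j2.
by rewrite outdegT reg //; apply: valP.
Qed.

End Automorphism.

(** * Digraphs of degree three *)

Lemma moore_bound_mul d k : d * moore_bound d.+1 k = (d.+1 ^ k.+1).-1.
Proof. by rewrite predn_exp. Qed.

Section DegreeThree.
Variables (k : nat) (V : finType) (e : rel V) (o : V -> V).
Hypotheses (oP : is_outlier k e o) (k_gt1 : 1 < k) (o_inj : injective o).
Hypothesis o_hom : forall u v, e (o u) (o v) = e u v.
Hypothesis outdeg3 : forall u, outdeg e u = 3.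
Hypothesis cardV : #|V| = (moore_bound 3 k).+1.

(** The nonempty cases correspond to the degrees 0, 1, 2 and 3 of the induced subdigraph. The cycle
    case also records one out-neighbour inside and one outside. *)
Inductive fixpts_spec (F : {set V}) : Prop :=
| FixptsEmpty of F = set0
| FixptsPair of #|F| = 2
| FixptsCycle of #|F| = k.+2 & (forall u, u \in F -> order o u = k.+2)
    & (forall u, u \in F -> exists v y, [/\ e u v, v \in F, e u y & y \notin F])
| FixptsTwo of #|F| = 2 ^ k.+1
| FixptsFull of F = setT.

Lemma fixptsP j : fixpts_spec (fixpts o j).
Proof.
have [-> | F0] := eqVneq (fixpts o j) set0; first exact: FixptsEmpty.
have [d cardF reg] := fixpts_regular oP o_inj o_hom F0.
have /set0Pn[u uF] := F0.
have: d <= 3.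
  rewrite -(reg u uF) -(outdeg3 u); apply: subset_leq_card.
  by apply/subsetP => v; rewrite !inE => /andP[].
case: d cardF reg => [|[|[|[|]]]] // cardF reg _.
- by apply: FixptsPair; rewrite cardF /moore_bound big_ord_recl big1 // => i _;
  rewrite exp0n.
- apply: FixptsCycle.
  + rewrite cardF /moore_bound (eq_bigr (fun _ => 1)) => [|i _]; last by rewrite exp1n.
    by rewrite sum1_card card_ord.
  + by apply: (fixpts_order1 oP o_inj o_hom (ltnW k_gt1) reg).
  move=> x xF; have /eqP/cards1P[v vE] := reg x xF.
  have : v \in [set v in fixpts o j | e x v] by rewrite vE set11.
  case/setIdP=> vF xv; exists v.
  have : ~~ ([set y | e x y] \subset [set v]).
    by apply/negP => /subset_leq_card; rewrite -/(outdeg e x) outdeg3 cards1.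
  case/subsetPn=> y; rewrite inE => xy yv; exists y; split=> //.
  by apply: contra yv => yF; rewrite -vE; apply/setIdP.
- by apply: FixptsTwo;
  rewrite cardF -(mul1n (moore_bound _ _)) moore_bound_mul prednK ?expn_gt0.
- by apply: FixptsFull; apply/eqP; rewrite eqEcard subsetT cardsT cardV cardF /=.
Qed.

(** The map [iter m o] fixes [u], hence permutes its three out-neighbours. It fixes [v], so it fixes
    or exchanges the other two. *)
Lemma swap_order m u v y :
  order o u %| m -> order o v %| m -> e u v -> e u y -> order o y %| m.*2.
Proof.
rewrite -!iter_eq_order // => /eqP um /eqP vm uv uy.
rewrite -addnn iterD; set g := iter m o in um vm *.
have g_inj : injective g by apply: iter_inj.
have g_out w : e u w -> e u (g w) by rewrite -{2}um /g iter_hom.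
have [-> | yv] := eqVneq y v; first by rewrite !vm.
have [yg|yg] := eqVneq (g y) y; first by rewrite !yg.
apply: contraTT isT => ggy.
have v_neq w : v != w -> v != g w by move=> vw; rewrite -{1}vm (inj_eq g_inj).
have uniq4 : uniq [:: v; y; g y; g (g y)].
  have vy : v != y by rewrite eq_sym.
  have vgy := v_neq _ vy; have vggy := v_neq _ vgy.
  rewrite /= !inE !negb_or vy vgy vggy [y == g y]eq_sym yg.
  by rewrite [y == _]eq_sym ggy (inj_eq g_inj) [y == _]eq_sym yg.
have : {subset [:: v; y; g y; g (g y)] <= enum [set w | e u w]}.
  move=> w; rewrite mem_enum !inE => /or4P[] /eqP-> //; first exact: g_out.
  exact/g_out/g_out.
by move/(uniq_leq_size uniq4); rewrite -cardE -/(outdeg e u) outdeg3.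
Qed.

(* A single orbit would make the digraph a circulant, where u + i + j is reached
   from u by the two walks through u + i and u + j. *)
Lemma outlier_not_transitive u : order o u != #|V|.
Proof.
apply/eqP => ord_u.
have orbit_u w : exists n, w = iter n o u.
  have: [set w | fconnect o u w] == [set: V].
    by rewrite eqEcard subsetT cardsT -ord_u cardsE leqnn.
  move/eqP/setP/(_ w); rewrite !inE => /iter_findex uw.
  by exists (findex o u w).
have : 1 < #|[set w | e u w]| by rewrite -/(outdeg e u) outdeg3.
case/card_gt1P=> v [w []]; rewrite !inE => uv uw vw.
have [i vE] := orbit_u v; have [j wE] := orbit_u w.
case/eqP: vw; apply: (two_walk_unique oP k_gt1 uv _ uw (v := iter (i + j) o u)).
  by rewrite vE iterD [iter i o _]/= (iter_hom o_hom) -wE.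
by rewrite addnC wE iterD (iter_hom o_hom) -vE.
Qed.

Hypotheses (k_odd : odd k) (prime_V : prime #|V|).

(** Take for [r] the odd part of [#|V|]!. Doubling the exponent preserves the parity of the number
    of fixed points, which ends at the odd number [#|V|]; the sizes 0, 2 and 2^(k+1) are even. *)
Lemma exists_odd_fixpts : exists2 r, odd r &
  fixpts o r = setT \/ #|fixpts o r| = k.+2.
Proof.
have V_gt2 : 2 < #|V|.
  rewrite cardV /moore_bound; case: k k_gt1 => [|m] // _.
  by rewrite 2!big_ord_recl expn0 add1n !ltnS.
have V_odd : odd #|V|.
  by have [V2|] := even_prime prime_V; first by rewrite V2 in V_gt2.
have full : fixpts o (#|V|`!) = setT.
  by apply/setP => x; rewrite !inE dvdn_fact // order_gt0 max_card.
have [r r_odd rE] := pfactor_coprime (isT : prime 2) (fact_gt0 #|V|).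
have {}r_odd : odd r by rewrite -coprime2n.
exists r => //.
have odd_card a : odd #|fixpts o (r * 2 ^ a)| = odd #|fixpts o r|.
  elim: a => [|a IHa]; first by rewrite muln1.
  have := fixpts_mod o_inj (r * 2 ^ a) (isT : prime 2);
    rewrite -mulnA -expnSr !modn2 -IHa.
  by case: (odd _); case: (odd _).
have: odd #|fixpts o r|.
  by rewrite -(odd_card (logn 2 #|V|`!)) -rE full cardsT.
by case: (fixptsP r) => [->|->|->|->|->]; rewrite ?cards0 ?oddX //; [right|left].
Qed.

Lemma two_dvd_pow q m : prime q -> q != 2 -> q %| 2 ^ m.+1 = false.
Proof. by move=> q_pr q2; rewrite Euclid_dvdX // andbT dvdn_prime2 // (negbTE q2). Qed.

Lemma not_odd_order r : odd r -> fixpts o r = setT -> False.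
Proof.
move=> r_odd full.
have ord_r x : order o x %| r by have := in_setT x; rewrite -full inE.
have [u0 _] : {u0 : V | true} by apply/sigW; have /card_gt0P[x _] := prime_gt0 prime_V;
  exists x.
case: (arg_minnP (order o) (isT : (fun _ => true) u0)) => u _ min_u.
have ord_odd : odd (order o u) := dvdn_odd (ord_r u) r_odd.
pose q := pdiv (order o u).
have ord_neq1 : order o u != 1.
  apply/eqP => ord1; have := outlier_neq oP u; have := iter_order o_inj u.
  by rewrite ord1 /= => ->; rewrite eqxx.
have q_pr : prime q.
  by apply: pdiv_prime; rewrite ltn_neqAle eq_sym ord_neq1 order_gt0.
have q_dvd : q %| order o u by apply: pdiv_dvd.
have q_neq2 : q != 2.
  by apply: contraL ord_odd => /eqP q2; rewrite -dvdn2 -q2.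
(* By minimality no orbit length divides [order o u %/ q], so [fixpts_mod] compares with an empty
   set. *)
have q_card : q %| #|fixpts o (order o u)|.
  rewrite /dvdn -{1}(divnK q_dvd) fixpts_mod // (_ : fixpts _ _ = set0) ?cards0 ?mod0n
    //.
  apply/setP => w; rewrite !inE; apply/negP => /dvdn_leq.
  rewrite divn_gt0 ?prime_gt0 // dvdn_leq ?order_gt0 // => /(_ isT).
  apply/negP; rewrite -ltnNge; apply: leq_trans (min_u w isT).
  by rewrite ltn_Pdiv ?prime_gt1 ?order_gt0.
have u_fix : u \in fixpts o (order o u) by rewrite inE.
case: (fixptsP (order o u)) => [F0|F2|_ _ F1|F2|Ffull].
- by rewrite F0 inE in u_fix.
- by rewrite F2 -[2]expn1 two_dvd_pow in q_card.
- have [v [y [uv vF uy /negP[]]]] := F1 u u_fix; rewrite inE.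
  rewrite -(@Gauss_dvdr _ 2) ?mul2n.
    by apply: swap_order uv uy => //; rewrite inE in vF.
  by rewrite coprimen2 (dvdn_odd (ord_r y)).
- by rewrite F2 two_dvd_pow in q_card.
move: q_card; rewrite Ffull cardsT dvdn_prime2 // => /eqP qV.
have := outlier_not_transitive u; rewrite eqn_leq max_card -qV.
by rewrite dvdn_leq // order_gt0.
Qed.

Variables (q m : nat).
Hypotheses (q_pr : prime q) (q_gt2 : 2 < q) (k2E : k.+2 = m * q).
Hypotheses (two_q : 2 ^ k.+1 = 1 %[mod q]) (V_q : #|V| = 1 %[mod q]).
Hypothesis m_cases : m = 1 \/
  [/\ prime m, 2 < m, 2 ^ k.+1 != 0 %[mod m] & 2 ^ k.+1 != 2 %[mod m]].

Lemma outlier_contradiction : False.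
Proof.
have [r r_odd [full | cardC]] := exists_odd_fixpts; first exact: not_odd_order full.
have [u uC] : exists u, u \in fixpts o r by apply/card_gt0P; rewrite cardC.
have cyc : (forall x, x \in fixpts o r -> order o x = k.+2) /\
    exists v y, [/\ e u v, v \in fixpts o r, e u y & y \notin fixpts o r].
  case: (fixptsP r) => [F0|F2|_ ordF F1|F2|Ffull].
  - by rewrite F0 cards0 in cardC.
  - by rewrite F2 in cardC; case: cardC k_gt1 => <-.
  - by split=> //; apply: F1.
  - by have := congr1 odd cardC; rewrite F2 oddX /= k_odd.
  - by case: (not_odd_order r_odd Ffull).
have [ordC [v [y [uv vC uy yC]]]] := cyc.
have y_fix : y \in fixpts o k.+2.*2.
  rewrite inE; apply: (swap_order (u := u) (v := v)) => //.
    by rewrite ordC.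
  by rewrite ordC.
have C_fix : fixpts o r \proper fixpts o k.+2.*2.
  rewrite properE; apply/andP; split; last by apply/subsetPn; exists y.
  by apply/subsetP => x xC; rewrite inE ordC // -muln2 dvdn_mulr.
(* More than [k.+2] fixed points leave only the sizes 2^(k+1) and [#|V|]. *)
have card_fix : #|fixpts o k.+2.*2| = 1 %[mod q].
  have := proper_card C_fix; rewrite cardC.
  case: (fixptsP k.+2.*2) => [->|->|-> _ _|->|->]; rewrite ?cards0 ?ltnn ?cardsT //.
have u_fix j : (u \in fixpts o j) = (k.+2 %| j) by rewrite inE ordC.
have u_m : u \notin fixpts o m.*2.
  rewrite u_fix k2E -muln2 dvdn_pmul2l.
    by apply/negP => /(dvdn_leq (ltn0Sn 1)); rewrite leqNgt q_gt2.
  by case: (m) k2E.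
(* The residue 1 modulo [q] excludes the sizes 0, 2 and [k.+2], and [u] excludes the full set. *)
have m_card : #|fixpts o m.*2| = 2 ^ k.+1.
  have eq1 : #|fixpts o m.*2| = 1 %[mod q].
    by rewrite -(fixpts_mod o_inj _ q_pr) -doubleMl -k2E.
  have q1 := modn_small (ltnW q_gt2).
  case: (fixptsP m.*2) eq1 u_m => [->|->|-> _ _|//|->]; rewrite ?inE //.
  - by rewrite cards0 mod0n q1.
  - by rewrite q1 modn_small.
  - by rewrite k2E modnMl q1.
have fix2 : fixpts o 2 != set0 -> #|fixpts o 2| = 2.
  exact: (fixpts_involution oP o_inj o_hom k_gt1 (erefl 2)).
case: m_cases => [m1 | [m_pr m_gt2 m0 m2]].
  move: m_card; rewrite m1 => m_card.
  have := fix2; rewrite m_card -card_gt0 m_card expn_gt0 => /(_ isT)/eqP.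
  by rewrite -{2}[2]expn1 eqn_exp2l // => /eqP[k0]; move: k_gt1; rewrite k0.
(* Modulo [m] the size 2^(k+1) would have to agree with 0 or 2. *)
have := fixpts_mod o_inj 2 m_pr; rewrite mul2n m_card.
have [->|/fix2->] := eqVneq (fixpts o 2) set0.
  by rewrite cards0; apply/eqP.
by apply/eqP.
Qed.

End DegreeThree.

(** * Primality certificates on binary numbers *)

Section Pocklington.

Fixpoint powmod (b : N) (e : positive) (n : N) : N :=
  match e with
  | xH => N.modulo b n
  | xO e' => let t := powmod b e' n in N.modulo (t * t)%num n
  | xI e' => let t := powmod b e' n in N.modulo (N.modulo (t * t)%num n * b)%num n
  end.

Lemma to_nat_mod a n : N.to_nat (N.modulo a n) = N.to_nat a %[mod N.to_nat n].
Proof.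
have := N.div_mod' a n => /(congr1 N.to_nat).
rewrite N2Nat.inj_add N2Nat.inj_mul plusE multE => ->.
by rewrite mulnC modnMDl.
Qed.

Lemma powmodE b e n :
  N.to_nat (powmod b e n) = N.to_nat b ^ Pos.to_nat e %[mod N.to_nat n].
Proof.
have sqE t m : N.to_nat t = m %[mod N.to_nat n] ->
    N.to_nat (N.modulo (t * t)%num n) = m ^ 2 %[mod N.to_nat n].
  by move=> tm; rewrite to_nat_mod N2Nat.inj_mul multE mulnn -modnXm tm modnXm.
elim: e => [e /sqE IHe|e /sqE IHe|]; last first.
- by rewrite [LHS]to_nat_mod Pos2Nat.inj_1 expn1.
- have -> : Pos.to_nat (xO e) = Pos.to_nat e * 2 by rewrite mulnC;
  apply: Pos2Nat.inj_xO.
  by rewrite [LHS]IHe -expnM.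
have -> : Pos.to_nat (xI e) = (Pos.to_nat e * 2).+1 by rewrite mulnC;
  apply: Pos2Nat.inj_xI.
rewrite [LHS]to_nat_mod N2Nat.inj_mul multE -modnMml IHe modnMml.
by rewrite [in RHS]expnSr expnM.
Qed.

Lemma Fermat_coprime_exp p q b : prime p -> prime q ->
  b ^ q = 1 %[mod p] -> b != 1 %[mod p] -> q %| p.-1.
Proof.
move=> p_pr q_pr bq; apply: contraNT => ndvd.
have p_gt1 := prime_gt1 p_pr.
have co_bp : coprime b p.
  rewrite coprime_sym prime_coprime //; apply/negP => /eqP b0.
  move: bq; rewrite -modnXm b0 exp0n ?prime_gt0 // mod0n modn_small //.
have bp : b ^ p.-1 = 1 %[mod p].
  by rewrite -(Euler_exp_totient co_bp) totient_prime.
have [u v uv _] := egcdnP p.-1 (prime_gt0 q_pr).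
have co : gcdn q p.-1 = 1 by apply/eqP; rewrite -/(coprime _ _) prime_coprime.
apply/eqP; rewrite co in uv.
have: b ^ (u * q) = 1 %[mod p] by rewrite mulnC expnM -modnXm bq modnXm exp1n.
by rewrite uv addn1 expnS (mulnC v) expnM -modnMmr -modnXm bp modnXm exp1n modnMmr
  muln1.
Qed.

(** The relation says that [b] - 1 is invertible modulo [n], so [b] is not 1 modulo any prime [p]
    dividing [n] and has multiplicative order [q] there. *)
Lemma prime_divisor_cong (n q b u v : N) : prime (N.to_nat q) ->
  (if q is Npos e then powmod b e n else 0)%num = 1%num ->
  (u * b = v * n + 1 + u)%num ->
  forall p, prime p -> p %| N.to_nat n -> N.to_nat q %| p.-1.
Proof.
case: q => [|e] // q_pr pow1 bezout p p_pr p_dvd.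
apply: (Fermat_coprime_exp p_pr q_pr (b := N.to_nat b)).
  have := powmodE b e n; rewrite pow1 => /(congr1 (modn^~ p)).
  by rewrite !modn_dvdm.
apply/negP => /eqP b1; have := congr1 N.to_nat bezout.
rewrite !(N2Nat.inj_add, N2Nat.inj_mul) !(plusE, multE) => bezout_nat.
have /eqP : 0 + N.to_nat u = 1 + N.to_nat u %[mod p].
  rewrite add0n -{1}(muln1 (N.to_nat u)) -modnMmr -b1 modnMmr bezout_nat -addnA.
  by rewrite -modnDml (eqP (dvdn_mull _ p_dvd)) add0n.
by rewrite eqn_modDr mod0n modn_small // prime_gt1.
Qed.

(** Every prime divisor of [n] is 1 modulo 2f, hence at least 2f + 1, whose square exceeds [n]. The
    witnesses [g] and [h] certify oddness, [c] the inequality. *)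
Lemma prime_large_divisors (n f g h c : N) :
  (forall p, prime p -> p %| N.to_nat n -> N.to_nat f %| p.-1) ->
  (n = g + g + 3)%num -> (f = h + h + 1)%num ->
  ((f + f + 1) * (f + f + 1) = n + 1 + c)%num -> prime (N.to_nat n).
Proof.
move=> div nE fE cE.
have [n3 n_odd] : 2 < N.to_nat n /\ odd (N.to_nat n).
  rewrite nE !N2Nat.inj_add !plusE addnn [N.to_nat 3]/=.
  by rewrite addn3 !ltnS /= odd_double.
have f_odd : odd (N.to_nat f).
  by rewrite fE !N2Nat.inj_add !plusE addnn oddD odd_double.
have n_gt0 : 0 < N.to_nat n by apply: leq_trans n3.
apply: ltn_pdiv2_prime => //; set p := pdiv _.
have p_pr : prime p by apply/pdiv_prime/ltnW.
have p_dvd : p %| N.to_nat n by apply: pdiv_dvd.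
have p_odd : odd p := dvdn_odd p_dvd n_odd.
have ff : (N.to_nat f).*2 %| p.-1.
  rewrite -mul2n Gauss_dvd ?coprime2n // div // dvdn2.
  by rewrite andbT -oddS prednK ?prime_gt0.
have : (N.to_nat f).*2.+1 <= p.
  rewrite -(prednK (prime_gt0 p_pr)) ltnS dvdn_leq //.
  by rewrite -ltnS prednK ?prime_gt0 ?prime_gt1.
rewrite -leq_sqr; apply: leq_trans.
have := congr1 N.to_nat cE.
rewrite !(N2Nat.inj_add, N2Nat.inj_mul) !(plusE, multE) addnn mulnn !addn1 => ->.
exact: leq_addr.
Qed.

Lemma moore_bound3 k : (moore_bound 3 k).+1.*2 = (3 ^ k.+1).+1.
Proof. by rewrite doubleS -mul2n moore_bound_mul prednK // expn_gt0. Qed.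

Lemma moore_bound3_bin k m n : k.+1 = 2 ^ m ->
  (n + n)%num = (iter m (fun x => x * x) 3 + 1)%num ->
  (moore_bound 3 k).+1 = N.to_nat n.
Proof.
move=> kE nE; apply: double_inj; rewrite moore_bound3 kE -addnn.
have := congr1 N.to_nat nE; rewrite !N2Nat.inj_add !plusE => ->.
rewrite -addn1; congr (_ + _); elim: m {kE nE} => // m IHm.
by rewrite expnS mulnC expnM IHm iterS N2Nat.inj_mul multE mulnn.
Qed.

Lemma prime_moore3_3 : prime (moore_bound 3 3).+1.
Proof. by rewrite /moore_bound !big_ord_recl big_ord0. Qed.

(* Each of the primes (3 ^ 16 + 1) / 2, (3 ^ 32 + 1) / 2 and (3 ^ 64 + 1) / 2
   serves in the certificate of the next one, whose predecessor it divides. *)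
Lemma prime_21523361 : prime (N.to_nat 21523361).
Proof.
(* Here the divisor 3281 = (3^8 + 1) / 2 = 17 * 193 is composite, so its prime factors are certified
   separately. *)
have p17 : forall p, prime p -> p %| N.to_nat 21523361 -> 17 %| p.-1.
  by apply: (@prime_divisor_cong _ 17 21122002 17147527 16827766).
have p193 : forall p, prime p -> p %| N.to_nat 21523361 -> 193 %| p.-1.
  by apply: (@prime_divisor_cong _ 193 19356814 13698598 12319693).
apply: (@prime_large_divisors _ 3281 10761679 1640 21549607) => // p p_pr p_dvd.
by rewrite (_ : N.to_nat 3281 = 17 * 193) // Gauss_dvd // p17 ?p193.
Qed.

Lemma prime_926510094425921 : prime (N.to_nat 926510094425921).
Proof.
apply: (@prime_large_divisors _ 21523361 463255047212959 10761680 926510266612807) =>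
  //.
apply: (prime_divisor_cong prime_21523361 (b := 317525112328107)
  (u := 875498647355633) (v := 300042933171657)); by vm_compute.
Qed.

Lemma prime_1716841910146256242328924544641 : prime (N.to_nat
  1716841910146256242328924544641).
Proof.
apply: (@prime_large_divisors _ 926510094425921 858420955073128121164462272319
  463255047212960 1716841910146263654409679952007) => //.
apply: (prime_divisor_cong prime_926510094425921 (b := 1310635564311658263532632555889)
  (u := 860475540473042200276003126482) (v := 656886250795328667758239800415));
    by vm_compute.
Qed.

End Pocklington.

(** * Diregularity makes the outlier function an automorphism *)

Section DiregularOutlier.
Variables (d k : nat) (V : finType) (e : rel V) (o : V -> V).
Hypotheses (oP : is_outlier k e o) (cardV : #|V| = (moore_bound d k).+1).
Hypotheses (out_reg : forall u, outdeg e u = d) (in_reg : forall v, indeg e v = d).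

(** In-regularity makes every column of I + A + ... + A^k sum to M(d,k), so every column of P sums
    to 1. *)
Lemma outlier_inj : injective o.
Proof.
have nwalks_to n v : \sum_u nwalks e n u v = d ^ n.
  elim: n v => [|n IHn] v; first by rewrite (bigD1 v) //= eqxx big1 // => u /negbTE->.
  rewrite (eq_bigr _ (fun u _ => nwalksSr e n u v)) exchange_big /=.
  rewrite (eq_bigr _ (fun w _ => IHn w)) sum_nat_const expnS -(in_reg v).
  by congr (_ * _); apply: eq_card => w; rewrite !inE.
have card_preim v : #|[set u | o u == v]| = 1.
  apply/eqP; rewrite -(eqn_add2l (moore_bound d k)) addn1 -cardV; apply/eqP.
  transitivity (\sum_u reach e k u v + #|[set u | o u == v]|).
    by congr (_ + _); rewrite /reach exchange_big; apply: eq_bigr => n _.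
  rewrite -!sum1_card [X in _ + X]big_mkcond -big_split; apply: eq_bigr => u _.
  by rewrite oP inE eq_sym; case: (_ == _).
move=> x y oxy; have /card_le1_eqP fib1 : #|[set u | o u == o x]| <= 1.
  by rewrite card_preim.
by apply: fib1; rewrite inE ?oxy.
Qed.

Lemma outlier_hom u v : e (o u) (o v) = e u v.
Proof.
have := outlier_degrees oP u (o v); rewrite out_reg in_reg => /addnI.
have -> : #|[set w | e u w & o w == o v]| = e u v.
  rewrite -sum1_card (eq_bigl (fun w => (w == v) && e u v)) => [|w].
    case: (e u v); first by rewrite (big_pred1 v) // => w; rewrite andbT.
    by rewrite big_pred0 // => w; rewrite andbF.
  by rewrite inE (inj_eq outlier_inj) andbC; case: eqP => [->|].
by case: (e (o u) (o v)); case: (e u v).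
Qed.

End DiregularOutlier.

(** * Arithmetic of the three cases and conclusion *)

(** With p = 2k + 1, if 3^(k+1) were 1, squaring and Fermat would give 9 = 3^(p+1) = 1, so p would
    divide 8. *)
Lemma pow3_neq1_mod k : 1 < k -> prime k.*2.+1 ->
  (3%:R ^+ k * (3%:R ^+ k.+1 - 1) != 0 :> 'F_(k.*2.+1))%R.
Proof.
move=> k_gt1 p_pr; set p := k.*2.+1 in p_pr *.
have p_gt3 : 3 < p by rewrite ltnS (@leq_trans 2.*2) // leq_double.
have natF n : (n%:R == 0 :> 'F_p)%R = (p %| n) by rewrite (GRing.dvdn_pcharf (pchar_Fp
  p_pr)).
have neq0 : (3%:R != 0 :> 'F_p)%R by rewrite natF gtnNdvd.
rewrite GRing.mulf_neq0 ?GRing.expf_neq0 // GRing.subr_eq0; apply/negP => /eqP pow1.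
have : (3%:R ^+ p = 3%:R :> 'F_p)%R by have := expf_card (3%:R : 'F_p)%R;
  rewrite card_Fp.
move/(congr1 (fun x => 3%:R * x)%R); rewrite -GRing.exprS.
have -> : p.+1 = k.+1 * 2 by rewrite muln2.
rewrite GRing.exprM pow1 GRing.expr1n -GRing.natrM => /eqP.
rewrite eq_sym -GRing.subr_eq0 -[1%R]/(1%:R)%R -GRing.natrB // natF.
rewrite -[_ - 1]/(2 ^ 3) Euclid_dvdX // andbT => /dvdn_leq -/(_ isT).
by rewrite leqNgt (ltn_trans _ p_gt3).
Qed.

Lemma moore_bound3_mod k q : odd q -> 3 ^ k.+1 = 1 %[mod q] ->
  (moore_bound 3 k).+1 = 1 %[mod q].
Proof.
move=> q_odd /eqP; rewrite eqn_mod_dvd ?expn_gt0 // subn1 -moore_bound_mul => q_dvd.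
apply/eqP; rewrite eqn_mod_dvd // subn1 /=.
by rewrite -(Gauss_dvdr _ (_ : coprime q 2)) ?coprimen2.
Qed.

Lemma expn_mod_period q a x y z :
  a ^ x = 1 %[mod q] -> a ^ (x * y + z) = a ^ z %[mod q].
Proof.
by move=> ax; rewrite expnD expnM -modnMml -modnXm ax modnXm exp1n modnMml mul1n.
Qed.

Lemma no_excess_degree3 k m q :
  odd k -> 1 < k -> prime k.*2.+1 -> prime (moore_bound 3 k).+1 ->
  prime q -> 2 < q -> k.+2 = m * q ->
  2 ^ k.+1 = 1 %[mod q] -> 3 ^ k.+1 = 1 %[mod q] ->
  m = 1 \/ [/\ prime m, 2 < m, 2 ^ k.+1 != 0 %[mod m] & 2 ^ k.+1 != 2 %[mod m]] ->
  ~ (exists (V : finType) (e : rel V), excess_one_digraph 3 k e).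
Proof.
move=> k_odd k_gt1 p_pr N_pr q_pr q_gt2 k2E two_q three_q m_cases [V [e exc]].
have [o oP] := excess_outlier (ltn0Sn 2) k_gt1 exc.
have [_ _ cardV] := exc.
have out_reg : forall u, outdeg e u = 3 := excess_outdeg (ltn0Sn 2) k_gt1 exc.
have in_reg v : indeg e v = 3.
  exact: (excess_indeg oP k_gt1 out_reg cardV p_pr (pow3_neq1_mod k_gt1 p_pr)).
have q_odd : odd q by case: (even_prime q_pr) => // q2; rewrite q2 in q_gt2.
apply: (outlier_contradiction oP k_gt1 _ _ out_reg cardV k_odd _ q_pr q_gt2 k2E two_q _
  m_cases).
- exact: outlier_inj oP cardV in_reg.
- exact: outlier_hom oP cardV out_reg in_reg.
- by rewrite cardV.
- by rewrite cardV moore_bound3_mod.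
Qed.

Theorem corollary12 :
  [/\ ~ (exists (V : finType) (e : rel V), excess_one_digraph 3 3 e),
      ~ (exists (V : finType) (e : rel V), excess_one_digraph 3 15 e)
    & ~ (exists (V : finType) (e : rel V), excess_one_digraph 3 63 e)].
Proof.
split.
- apply: (@no_excess_degree3 3 1 5) => //; first exact: prime_moore3_3.
  by left.
- apply: (@no_excess_degree3 15 1 17 isT isT isT _ isT isT erefl).
  + rewrite (@moore_bound3_bin 15 4 21523361 erefl); first exact: prime_21523361.
    by vm_compute.
  + exact: (@expn_mod_period 17 2 8 2 0).
  + have three4 : 3 ^ 4 = 13 %[mod 17] by [].
    by rewrite -[15.+1]/(4 * 4) expnM -modnXm three4 modnXm.
  by left.
(* Here k + 2 = 65 = 13 * 5 is composite, hence the second descent, with the prime 13. *)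
apply: (@no_excess_degree3 63 13 5 isT isT isT _ isT isT erefl).
- rewrite (@moore_bound3_bin 63 6 1716841910146256242328924544641 erefl).
    exact: prime_1716841910146256242328924544641.
  by vm_compute.
- exact: (@expn_mod_period 5 2 4 16 0).
- exact: (@expn_mod_period 5 3 4 16 0).
right.
(* The residue is 3, which is neither 0 nor 2. *)
have two13 : 2 ^ 64 = 2 ^ 4 %[mod 13] := @expn_mod_period 13 2 12 5 4 erefl.
by split; rewrite ?two13.
Qed.
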